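(* Let $\mathbf{F}_2$ be the group freely generated by $a,b$, and for $N\in\mathbb{N}$ let $B_N\subseteq\mathbf{F}_2$ be the set of reduced words of length at most $N$ in the alphabet $\{a,a^{-1},b,b^{-1}\}$. For all measure preserving systems $(X,\mathcal{B},\mu,(T_g)_{g\in\mathbf{F}_2})$ and all $Y\in\mathcal{B}$, the following limit exists and satisfies $$\lim_{N\to\infty}\frac{1}{|B_{2N}|}\sum_{g\in B_{2N}}\mu(Y\cap T_gY)\geq\mu(Y)^2.$$
   Context: A measure preserving system $(X,\mathcal{B},\mu,(T_g)_{g\in G})$ consists of a probability space $(X,\mathcal{B},\mu)$ and a left action $(T_g)_{g\in G}$ of a group $G$ on $X$ by measure-preserving maps, so that $T_{gh}=T_g\circ T_h$. *)

(* Defs.v *)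
From HB Require Import structures.
From mathcomp Require Import all_boot all_order all_algebra.
From mathcomp Require Import all_classical all_reals all_analysis.

Set Implicit Arguments.
Unset Strict Implicit.
Unset Printing Implicit Defensive.

Import Order.TTheory GRing.Theory Num.Theory.
Import numFieldNormedType.Exports.

Local Open Scope classical_set_scope.

(* The alphabet: (false, false) is a, (false, true) is a^-1,
   (true, false) is b and (true, true) is b^-1. *)
Definition letter : Type := (bool * bool)%type.

Definition letter_inv (x : letter) : letter := (x.1, ~~ x.2).

Definition reduced (w : seq letter) : bool :=
  sorted (fun x y => y != letter_inv x) w.

(* [cons_reduce x w] is the reduced form of [x :: w] for a reduced [w]. *)
Definition cons_reduce (x : letter) (w : seq letter) : seq letter :=
  if w is y :: w' then if y == letter_inv x then w' else x :: w else [:: x].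

Definition reduce (w : seq letter) : seq letter := foldr cons_reduce [::] w.

Lemma letter_invK : involutive letter_inv.
Proof. by move=> [x s]; rewrite /letter_inv /= negbK. Qed.

Lemma letter_inv_sym x y : (y == letter_inv x) = (x == letter_inv y).
Proof. by rewrite eq_sym (can2_eq letter_invK letter_invK). Qed.

Lemma cons_reduce_reduced x w : reduced w -> reduced (cons_reduce x w).
Proof.
case: w => [|y w] //= Hw; case: ifPn => [_|Hxy]; first exact: path_sorted Hw.
by rewrite /reduced /= Hxy.
Qed.

Lemma foldr_cons_reduce_reduced u v :
  reduced v -> reduced (foldr cons_reduce v u).
Proof. by move=> Hv; elim: u => //= x u; exact: cons_reduce_reduced. Qed.

Lemma reduce_reduced w : reduced (reduce w).
Proof. exact: foldr_cons_reduce_reduced. Qed.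

Lemma cons_reduce_id x w : reduced (x :: w) -> cons_reduce x w = x :: w.
Proof. by case: w => //= y w /andP[/negPf-> _]. Qed.

Lemma reduce_id w : reduced w -> reduce w = w.
Proof.
elim: w => //= x w IH Hw.
by rewrite IH ?cons_reduce_id//; exact: path_sorted Hw.
Qed.

Lemma cons_reduceK x w :
  reduced w -> cons_reduce x (cons_reduce (letter_inv x) w) = w.
Proof.
case: w => [|y w] /= Hw; first by rewrite eqxx.
rewrite letter_invK; case: ifPn => [/eqP Hyx|_]; last by rewrite /= eqxx.
by subst y; exact: cons_reduce_id.
Qed.

Lemma foldr_cons_reduce u x w : reduced w ->
  foldr cons_reduce w (cons_reduce x u) = cons_reduce x (foldr cons_reduce w u).
Proof.
case: u => [|y u] //= Hw; case: ifPn => //= /eqP->.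
by rewrite cons_reduceK//; exact: foldr_cons_reduce_reduced.
Qed.

Lemma foldr_cons_reduceA u v w : reduced w ->
  foldr cons_reduce w (foldr cons_reduce v u) =
  foldr cons_reduce (foldr cons_reduce w v) u.
Proof. by move=> Hw; elim: u => //= x u <-; rewrite foldr_cons_reduce. Qed.

Lemma reduce_cat u v : reduced v -> reduce (u ++ v) = foldr cons_reduce v u.
Proof. by move=> Hv; rewrite /reduce foldr_cat -/(reduce v) reduce_id. Qed.

Definition inv_word (w : seq letter) : seq letter := rev (map letter_inv w).

Lemma inv_wordK : involutive inv_word.
Proof. by move=> w; rewrite /inv_word map_rev revK mapK//; exact: letter_invK. Qed.

Lemma inv_word_reduced w : reduced w -> reduced (inv_word w).
Proof.
rewrite /reduced /inv_word rev_sorted sorted_map; apply: sub_sorted => x y /=.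
by rewrite letter_invK eq_sym.
Qed.

Lemma foldr_cons_reduce_inv u w :
  reduced w -> foldr cons_reduce (foldr cons_reduce w (inv_word u)) u = w.
Proof.
elim: u w => //= x u IH w Hw.
rewrite /inv_word /= rev_cons foldr_rcons IH; last exact: cons_reduce_reduced.
exact: cons_reduceK.
Qed.

Record F2 := MkF2 { word :> seq letter; word_reduced : reduced word }.

HB.instance Definition _ := [isSub for word].
HB.instance Definition _ := [Choice of F2 by <:].

Definition F2_one : F2 := @MkF2 [::] isT.

Definition F2_mul (u v : F2) : F2 := MkF2 (reduce_reduced (u ++ v)).

Definition F2_inv (u : F2) : F2 := MkF2 (inv_word_reduced (word_reduced u)).

Lemma F2_mulA : associative F2_mul.
Proof.
move=> u v w; apply: val_inj; rewrite /= !reduce_cat ?word_reduced//.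
  by rewrite foldr_cons_reduceA// word_reduced.
exact: foldr_cons_reduce_reduced (word_reduced w).
Qed.

Lemma F2_mul1g : left_id F2_one F2_mul.
Proof. by move=> u; apply: val_inj; rewrite /= reduce_id// word_reduced. Qed.

Lemma F2_mulg1 : right_id F2_one F2_mul.
Proof.
by move=> u; apply: val_inj; rewrite /= cats0 reduce_id// word_reduced.
Qed.

Lemma F2_mulgV : right_inverse F2_one F2_inv F2_mul.
Proof.
move=> u; have Hu := inv_word_reduced (word_reduced u).
have := foldr_cons_reduce_inv u (isT : reduced [::]).
rewrite -/(reduce _) reduce_id// => uV.
by apply: val_inj; rewrite /= reduce_cat.
Qed.

Lemma F2_invK : involutive F2_inv.
Proof. by move=> u; apply: val_inj; exact: inv_wordK. Qed.

Lemma F2_mulVg : left_inverse F2_one F2_inv F2_mul.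
Proof. by move=> u; rewrite -{2}(F2_invK u) F2_mulgV. Qed.

HB.instance Definition _ :=
  isGroup.Build F2 F2_mulA F2_mul1g F2_mulg1 F2_mulVg F2_mulgV.

Definition F2_a : F2 := @MkF2 [:: (false, false)] isT.
Definition F2_b : F2 := @MkF2 [:: (true, false)] isT.

Section UniversalProperty.
Variables (H : groupType) (x y : H).

Let letter_val (l : letter) : H :=
  let z := if l.1 then y else x in if l.2 then (z^-1)%g else z.

Definition F2_lift (w : seq letter) : H :=
  foldr (fun l h => (letter_val l * h)%g) 1%g w.

Lemma F2_lift_cat u v : F2_lift (u ++ v) = (F2_lift u * F2_lift v)%g.
Proof. by elim: u => [|l u IH] /=; rewrite ?mul1g// IH mulgA. Qed.

Lemma F2_lift_reduce w : F2_lift (reduce w) = F2_lift w.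
Proof.
elim: w => //= l w <-; case: (reduce w) => //= k v; case: ifPn => // /eqP->.
by rewrite /= mulgA; case: l => [[] []]; rewrite /letter_val /= ?mulgV ?mulVg mul1g.
Qed.

Lemma F2_universal : exists! f : F2 -> H,
  [/\ f F2_a = x, f F2_b = y & {morph f : g h / (g * h)%g}].
Proof.
exists (fun g => F2_lift g); split.
  split; rewrite /= ?mulg1// => g h /=.
  by rewrite F2_lift_reduce F2_lift_cat.
move=> f [fa fb fM]; apply: funext => -[w rw] /=.
have f1 : f 1%g = 1%g.
  by apply: (@mulgI _ (f 1%g)); rewrite -fM !mulg1.
have fV g : f (g^-1)%g = ((f g)^-1)%g.
  by apply: (@mulgI _ (f g)); rewrite -fM !mulgV.
elim: w rw => [|l w IH] rw /=; first by rewrite -f1; congr f; exact: val_inj.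
have rw' : reduced w by exact: path_sorted rw.
rewrite (IH rw'); have -> : MkF2 rw = (@MkF2 [:: l] isT * MkF2 rw')%g.
  by apply: val_inj; rewrite /= -/(reduce w) reduce_id// cons_reduce_id.
rewrite fM; congr (_ * _)%g; case: l {rw} => [[] []]; rewrite /letter_val /=.
- by rewrite -fb -fV; congr f; exact: val_inj.
- by rewrite -fb; congr f; exact: val_inj.
- by rewrite -fa -fV; congr f; exact: val_inj.
- by rewrite -fa; congr f; exact: val_inj.
Qed.

End UniversalProperty.

Definition F2_ball (N : nat) : set F2 := [set g | (size (word g) <= N)%N].

Lemma finite_F2_ball N : finite_set (F2_ball N).
Proof.
pose F (p : N.-bseq (bool * bool)%type) : F2 := insubd F2_one (p : seq letter).
apply: (@sub_finite_set _ _ (F @` [set: N.-bseq (bool * bool)%type])).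
  by move=> g gN; exists (Bseq gN) => //; exact: valKd.
by apply: finite_image; exact: finite_finset.
Qed.

Record measure_preserving_action (G : groupType) (d : measure_display)
    (X : measurableType d) (R : realType) (mu : probability X R)
    (T : G -> X -> X) : Prop := MeasurePreservingAction {
  mp_act1 : T 1%g = id ;
  mp_actM : forall g h : G, T (g * h)%g = T g \o T h ;
  mp_measurable : forall g : G, measurable_fun [set: X] (T g) ;
  mp_preserving : forall (g : G) (A : set X),
    measurable A -> mu (T g @^-1` A) = mu A
}.

(* Main.v *)
From HB Require Import structures.
Require Import Defs.
From mathcomp Require Import all_boot all_order all_algebra.
From mathcomp Require Import finmap ring lra.
From mathcomp Require Import all_classical all_reals all_analysis.
From mathcomp Require Import measurable_realfun.
Import Order.TTheory GRing.Theory Num.Theory.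
Import numFieldNormedType.Exports.

Set Implicit Arguments.
Unset Strict Implicit.
Unset Printing Implicit Defensive.

Local Open Scope classical_set_scope.
Local Open Scope ring_scope.

(** Let [A] average a function on [X] over the translates by the four letters
    [a], [a^-1], [b], [b^-1]. It is a self-adjoint contraction of L^2, and averaging over the
    sphere of radius [n] is the operator [p_n(A)], where [p_0 = 1],
    [p_1 = 'X] and [3 p_(n+2) = 4 'X p_(n+1) - p_n], because a reduced word
    of positive length has three one-letter reduced extensions and one
    cancellation ([sphere_sum_markov]). With [f = 1_Y - mu Y], the functional
    [L P = <P(A) f, f>] on polynomials is nonnegative on squares and on
    [1 - 'X^2] times squares ([spectral_positive]); it stands for integration
    against the spectral measure of [f], a measure on [-1, 1].
    The correlation averages of the theorem are those of the numbers [L p_n]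
    over the balls, shifted by [mu(Y)^2] ([spectral_sphere],
    [correlation_centered]), so it remains to show that the averages of
    [L p_n] converge to a nonnegative limit.

    Two identities do this. The first comes from the invariant
    [3^n (3 p_(n+1)^2 - 4 'X p_n p_(n+1) + p_n^2) = 1 - 'X^2] and reads
    [p_n^2 - p_(n+1)^2 + 3^-n (1 - 'X^2)
       = 2 ((p_(n+1) - 'X p_n)^2 + (1 - 'X^2) p_n^2)].
    Since [L] is nonnegative on the right-hand side, [L (p_n^2)] is
    nonincreasing up to a summable error, hence converges to some [l >= 0]
    ([sphere_poly_sqr_cvg]). The second,
    [9 p_(2n+2) - p_(2n) = 12 p_(n+1)^2 - 4 p_n^2], is a contracting
    recurrence for [L p_(2n)] with convergent forcing, so [L p_(2n)] tends
    to [l] as well ([sphere_poly_even_cvg]). The functional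
    [P |-> L ((1 + 'X) P)] has the same positivity, so the same argument shows
    that [L p_(2n+1)] converges to some [l'] with [l + l' >= 0]
    ([sphere_poly_odd_cvg]). In the ball of radius [2N] the even spheres weigh
    3/4 and the odd ones 1/4 asymptotically, and
    [3/4 l + 1/4 l' = 1/2 l + 1/4 (l + l') >= 0]. An eigenvalue [-1] of
    [A] can make [l'] negative; balls of even radius favour the even
    spheres, which is what keeps the limit nonnegative. *)

(** * The polynomials of the sphere averages *)

Section Polys.
Variable R : numFieldType.

(** The pair [(p_n, p_(n+1))], which makes the two-step recurrence structural. *)
Fixpoint sphere_poly_pair (n : nat) : {poly R} * {poly R} :=
  if n is m.+1 then
    let: (p, q) := sphere_poly_pair m in (q, 3^-1 *: (4 * 'X * q - p))
  else (1, 'X).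

Definition sphere_poly n := (sphere_poly_pair n).1.
Local Notation p := sphere_poly.

Lemma sphere_poly0 : p 0 = 1. Proof. by []. Qed.
Lemma sphere_poly1 : p 1 = 'X. Proof. by []. Qed.

Lemma sphere_polySS n : 3 * p n.+2 = 4 * 'X * p n.+1 - p n.
Proof.
rewrite /sphere_poly /=; case: (sphere_poly_pair n) => a b /=.
by rewrite mulr_natl -scaler_nat scalerA mulfV ?pnatr_eq0// scale1r.
Qed.

(** The quadratic form in [(p_n, p_(n+1))] is divided by three at each step,
    because the two roots of [3 t^2 - 4 'X t + 1] have product 1/3. *)
Lemma sphere_poly_turan n :
  3 ^+ n * (3 * p n.+1 ^+ 2 - 4 * 'X * p n * p n.+1 + p n ^+ 2) = 1 - 'X ^+ 2.
Proof.
elim: n => [|n <-]; first by rewrite sphere_poly1 sphere_poly0; ring.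
have H := sphere_polySS n; rewrite exprSr -mulrA; congr (_ * _).
rewrite (_ : 3 * _ = (3 * p n.+2) ^+ 2 - 4 * 'X * p n.+1 * (3 * p n.+2) +
    3 * p n.+1 ^+ 2); last by ring.
by rewrite H; ring.
Qed.

Lemma poly3_inj : injective ( *%R (3 : {poly R})).
Proof. by apply: mulfI; rewrite -polyC_natr polyC_eq0 pnatr_eq0. Qed.

(** Both sides obey the same three-term recurrence, at the two parities; the
    odd identity carries the induction. In group terms, the even
    one comes from expanding [p_n^2] according to the number of letters
    cancelled in a product of two words of length [n]. *)
Lemma sphere_poly_double n :
  9 * p n.*2.+2 - p n.*2 = 12 * p n.+1 ^+ 2 - 4 * p n ^+ 2 /\
  9 * p n.*2.+3 - p n.*2.+1 = 12 * p n.+1 * p n.+2 - 4 * p n * p n.+1.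
Proof.
elim: n => [|n [IHe IHo]].
  have h2 := sphere_polySS 0; have h3 := sphere_polySS 1.
  rewrite sphere_poly1 sphere_poly0 in h2; rewrite sphere_poly1 in h3.
  rewrite double0 sphere_poly1 sphere_poly0; split.
    rewrite (_ : 9 * p 2 = 3 * (3 * p 2)); [rewrite h2|]; by ring.
  rewrite (_ : 9 * p 3 = 3 * (3 * p 3)); last by ring.
  rewrite h3 (_ : 3 * _ = 4 * 'X * (3 * p 2) - 3 * 'X); last by ring.
  rewrite (_ : 12 * _ * _ = 4 * 'X * (3 * p 2)); last by ring.
  by rewrite h2; ring.
have rec m : 3 * (9 * p m.+4 - p m.+2) =
    4 * 'X * (9 * p m.+3 - p m.+1) - (9 * p m.+2 - p m).
  have h2 := sphere_polySS m; have h4 := sphere_polySS m.+2.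
  rewrite (_ : 3 * _ = 9 * (3 * p m.+4) - 3 * p m.+2); last by ring.
  by rewrite h2 h4; ring.
have Ee : 9 * p n.+1.*2.+2 - p n.+1.*2 = 12 * p n.+2 ^+ 2 - 4 * p n.+1 ^+ 2.
  apply: poly3_inj; rewrite doubleS rec IHe IHo.
  have h := sphere_polySS n.
  have -> : p n = 4 * 'X * p n.+1 - 3 * p n.+2 by rewrite h; ring.
  by ring.
split => //; apply: poly3_inj; rewrite doubleS in Ee *; rewrite rec Ee IHo.
have -> : p n = 4 * 'X * p n.+1 - 3 * p n.+2 by rewrite sphere_polySS; ring.
have -> : p n.+1 = 4 * 'X * p n.+2 - 3 * p n.+3 by rewrite sphere_polySS; ring.
by ring.
Qed.

End Polys.

(** * Positive functionals on the interval [-1, 1] *)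

(** The distance to [l] is multiplied by [c] at each step, up to an error that
    tends to 0, so it is eventually below any bound. *)
Lemma cvg_affine_recurrence (R : realType) (c l : R) (x y : nat -> R) :
  `|c| < 1 -> (forall n, x n.+1 = c * x n + y n) ->
  y @ \oo --> (1 - c) * l -> x @ \oo --> l.
Proof.
move=> c1 xS yl; apply/cvgrPdist_le => e e0.
have c10 : 0 < 1 - `|c| by rewrite subr_gt0.
have e2 : 0 < e / 2 by rewrite divr_gt0.
have /cvgrPdist_le/(_ _ (mulr_gt0 c10 e2))[N _ yN] := yl.
have bound k : `|l - x (k + N)%N| <= `|c| ^+ k * `|l - x N| + e / 2.
  elim: k => [|k IH]; first by rewrite expr0 mul1r lerDl ltW.
  have -> : l - x (k.+1 + N)%N =
      c * (l - x (k + N)%N) + ((1 - c) * l - y (k + N)%N).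
    by rewrite addSn xS; ring.
  apply: le_trans (ler_normD _ _) _; rewrite normrM exprS -mulrA.
  have := yN (k + N)%N (leq_addl _ _) => /= yk.
  have ck := ler_wpM2l (normr_ge0 c) IH.
  by apply: le_trans (lerD ck yk) _; rewrite le_eqVlt; apply/orP; left; apply/eqP; ring.
have geo : (fun k => `|c| ^+ k * `|l - x N|) @ \oo --> (0 : R).
  rewrite -[X in _ --> X](mul0r `|l - x N|); apply: cvgMl.
  by apply: cvg_expr; rewrite ger0_norm.
have /cvgrPdist_le/(_ _ e2)[M _ cM] := geo.
exists (M + N)%N => // n /= Mn.
have nE : n = (n - N + N)%N by rewrite subnK// (leq_trans _ Mn)// leq_addl.
rewrite nE; apply: le_trans (bound _) _.
have Mk : (M <= n - N)%N by rewrite -(addnK N M) leq_sub2r.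
have := cM _ Mk; rewrite /= sub0r normrN => h.
rewrite [leRHS]splitr lerD2r; apply: le_trans (ler_norm _) h.
Qed.

Section Functional.
Variable R : realType.
Local Notation p := (@sphere_poly R).

(** The positivity shared by all integrals against positive measures on the
    interval [-1, 1]. *)
Definition positive_on_itv (L : {poly R} -> R) :=
  forall Q, 0 <= L (Q ^+ 2) /\ 0 <= L ((1 - 'X ^+ 2) * Q ^+ 2).

Definition mul_functional (Q : {poly R}) (L : {poly R} -> R) P := L (Q * P).

Section MulFunctional.
Variables (Q : {poly R}) (L : {scalar {poly R}}).

Lemma mul_functional_linear : scalar (mul_functional Q L).
Proof. by move=> a u v; rewrite /mul_functional mulrDr -scalerAr linearP. Qed.

HB.instance Definition _ :=
  GRing.isLinear.Build R {poly R} R *%R (mul_functional Q L) mul_functional_linear.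
End MulFunctional.

(** On [-1, 1] the weight [1 + 'X] is nonnegative, with the certificate
    [2 (1 + 'X) = (1 + 'X)^2 + (1 - 'X^2)]. *)
Lemma positive_on_itv_mul1DX (L : {scalar {poly R}}) :
  positive_on_itv L -> positive_on_itv (mul_functional (1 + 'X) L).
Proof.
move=> Lpos Q; rewrite /mul_functional; split.
  rewrite -(pmulr_rge0 _ (ltr0n R 2)) -linearZ/=.
  have -> : 2 *: ((1 + 'X) * Q ^+ 2) =
      ((1 + 'X) * Q) ^+ 2 + (1 - 'X ^+ 2) * Q ^+ 2.
    by rewrite scaler_nat; ring.
  by rewrite linearD/= addr_ge0//; have [] := Lpos Q; have [] := Lpos ((1 + 'X) * Q).
rewrite -(pmulr_rge0 _ (ltr0n R 2)) -linearZ/=.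
have -> : 2 *: ((1 + 'X) * ((1 - 'X ^+ 2) * Q ^+ 2)) =
    (1 - 'X ^+ 2) * ((1 + 'X) * Q) ^+ 2 + ((1 - 'X ^+ 2) * Q) ^+ 2.
  by rewrite scaler_nat; ring.
rewrite linearD/= addr_ge0//.
  by have [] := Lpos ((1 + 'X) * Q).
by have [] := Lpos ((1 - 'X ^+ 2) * Q).
Qed.

Lemma functional_natM (L : {scalar {poly R}}) (k : nat) P : L (k%:R * P) = k%:R * L P.
Proof. by rewrite mulr_natl raddfMn mulr_natl. Qed.

(** Twice the Lyapunov function
    [(p_(n+1) - 'X p_n)^2 + (1 - 'X^2) p_n^2] is the decrement of [p_n^2] plus
    [3^-n (1 - 'X^2)]. Adding [3/2 3^-n L (1 - 'X^2)], the tail of the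
    geometric error, to [L (p_n^2)] gives a nonincreasing sequence. *)
Lemma sphere_poly_sqr_cvg (L : {scalar {poly R}}) : positive_on_itv L ->
  exists2 l : R, 0 <= l & (fun n => L (p n ^+ 2)) @ \oo --> l.
Proof.
move=> Lpos; pose w := L (1 - 'X ^+ 2).
have w0 : 0 <= w by have [_] := Lpos 1; rewrite expr1n mulr1.
pose u n := 2^-1 * (3 * w) * 3^-1 ^+ n.
pose c n := L (p n ^+ 2) + u n.
have u0 n : 0 <= u n by rewrite !mulr_ge0// exprn_ge0.
have ucvg : u @ \oo --> (0 : R).
  rewrite -[X in _ --> X](mulr0 (2^-1 * (3 * w))); apply: cvgMr.
  by apply: cvg_expr; rewrite ger0_norm ?invr_ge0//; lra.
have c0 n : 0 <= c n by rewrite addr_ge0//; have [] := Lpos (p n).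
have cS n : c n.+1 <= c n.
  have [E1 _] := Lpos (p n.+1 - 'X * p n); have [_ E2] := Lpos (p n).
  have /(congr1 L) : (3 ^ n)%:R * (p n ^+ 2 - p n.+1 ^+ 2) + (1 - 'X ^+ 2) =
      (2 * 3 ^ n)%:R * ((p n.+1 - 'X * p n) ^+ 2 + (1 - 'X ^+ 2) * p n ^+ 2).
    by rewrite -[X in _ + X = _](sphere_poly_turan R n) natrM natrX; ring.
  rewrite linearD/= -/w !functional_natM linearB linearD/= natrM => H.
  have k0 : 0 < (3 ^ n)%:R :> R by rewrite ltr0n expn_gt0.
  have uE m : u m = 2^-1 * (3 * w) / (3 ^ m)%:R by rewrite /u exprVn natrX.
  rewrite /c !uE expnS natrM -subr_ge0.
  move: H k0 E1 E2.
  set k := (3 ^ n)%:R; set e1 := L (p n ^+ 2); set e2 := L (p n.+1 ^+ 2).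
  set e3 := L ((_ - _) ^+ 2); set e4 := L (_ * _).
  move=> H k0 E1 E2.
  have -> : e1 + 2^-1 * (3 * w) / k - (e2 + 2^-1 * (3 * w) / (3 * k)) = 2 * (e3 + e4).
    apply: (mulfI (lt0r_neq0 k0)).
    rewrite [RHS](_ : _ = 2 * k * (e3 + e4)); last by ring.
    by rewrite -H; field; rewrite gt_eqF.
  by rewrite mulr_ge0// addr_ge0.
have ccvg : cvgn c.
  apply: nonincreasing_is_cvgn; first by apply/nonincreasing_seqP.
  by exists 0 => _ [n _ <-].
exists (limn c); first by apply: limr_ge => //; apply: nearW.
have -> : (fun n => L (p n ^+ 2)) = (fun n => c n - u n).
  by apply: funext => n; rewrite /c addrK.
by rewrite -[X in _ --> X]subr0; apply: cvgB.
Qed.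

(** By [sphere_poly_double], [L p_(2n+2)] is [1/9 L p_(2n)] plus a sequence
    tending to [8/9] of the limit of [L (p_n^2)]. *)
Lemma sphere_poly_even_cvg (L : {scalar {poly R}}) : positive_on_itv L ->
  exists2 l : R, 0 <= l & (fun n => L (p n.*2)) @ \oo --> l.
Proof.
move=> /sphere_poly_sqr_cvg[l l0 pl]; exists l => //.
pose y n := 9^-1 * (12 * L (p n.+1 ^+ 2) - 4 * L (p n ^+ 2)).
apply: (@cvg_affine_recurrence _ 9^-1 l _ y).
- by rewrite ger0_norm ?invr_ge0//; lra.
- move=> n; have [/(congr1 L) H _] := sphere_poly_double R n.
  move: H; rewrite !linearB/= !functional_natM -doubleS /y => H.
  by apply: (mulfI (_ : 9 != 0 :> R)) => //; rewrite mulrDr !mulrA mulfV// !mul1r -H; ring.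
rewrite (_ : (1 - 9^-1) * l = 9^-1 * (12 * l - 4 * l)); last by field.
apply: cvgMr; apply: cvgB; apply: cvgMr => //.
by rewrite (cvg_shiftS (fun n => L (p n ^+ 2))).
Qed.

(** The even limit for the weight [1 + 'X] gives the limit of
    ['X p_(2n+2) = 3/4 p_(2n+3) + 1/4 p_(2n+1)], a recurrence of ratio [-1/3]
    for the odd terms. *)
Lemma sphere_poly_odd_cvg (L : {scalar {poly R}}) (l : R) : positive_on_itv L ->
  (fun n => L (p n.*2)) @ \oo --> l ->
  exists2 l' : R, 0 <= l + l' & (fun n => L (p n.*2.+1)) @ \oo --> l'.
Proof.
move=> Lpos pl.
have /sphere_poly_even_cvg[m m0 pm] := positive_on_itv_mul1DX Lpos.
exists (m - l); first by rewrite addrC subrK.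
pose y n := 3^-1 * (4 * (L ((1 + 'X) * p n.+1.*2) - L (p n.+1.*2))).
apply: (@cvg_affine_recurrence _ (- 3^-1) _ _ y).
- by rewrite normrN ger0_norm ?invr_ge0//; lra.
- move=> n; have /(congr1 L) := sphere_polySS R n.*2.+1.
  rewrite linearB/= functional_natM -mulrA functional_natM -doubleS /y.
  rewrite [(1 + 'X) * _]mulrDl mul1r linearD/= => H.
  by apply: (mulfI (_ : 3 != 0 :> R)) => //; rewrite doubleS H -doubleS; field.
rewrite (_ : (1 - - 3^-1) * (m - l) = 3^-1 * (4 * (m - l))); last by field.
apply: cvgMr; apply: cvgMr; apply: cvgB.
  by rewrite (cvg_shiftS (fun n => L ((1 + 'X) * p n.*2))).
by rewrite (cvg_shiftS (fun n => L (p n.*2))).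
Qed.

End Functional.

(** * Averages over balls of even radius *)

Definition sphere_size (n : nat) : nat := if n is m.+1 then (4 * 3 ^ m)%N else 1%N.

Lemma sum_sphere_size n : (\sum_(i < n.+1) sphere_size i).+1 = (2 * 3 ^ n)%N.
Proof.
elim: n => [|n IH]; first by rewrite big_ord1.
rewrite big_ord_recr/= -addSn IH expnS mulnCA mulnA.
by rewrite -mulnDl.
Qed.

(** The sphere of radius [n] fills a proportion close to [2/3 3^-(2N-n)] of the
    ball of radius [2N]; the even radii sum to 3/4 and the odd ones to 1/4.
    Dividing the sums by [9^N], which is half the ball size asymptotically,
    gives a recurrence of ratio 1/9. *)
Lemma ball_average_cvg (R : realType) (x : nat -> R) (l l' : R) :
  (fun n => x n.*2) @ \oo --> l -> (fun n => x n.*2.+1) @ \oo --> l' ->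
  (fun N => (\sum_(n < N.*2.+1) sphere_size n)%:R^-1 *
    \sum_(n < N.*2.+1) (sphere_size n)%:R * x n) @ \oo --> 3 / 4 * l + 1 / 4 * l'.
Proof.
move=> xl xl'.
pose t N := (9^-1 ^+ N) * \sum_(n < N.*2.+1) (sphere_size n)%:R * x n.
have tl : t @ \oo --> 3 / 2 * l + 1 / 2 * l'.
  apply: (@cvg_affine_recurrence _ 9^-1 _ _
    (fun N => 4 / 3 * x N.+1.*2 + 4 / 9 * x N.*2.+1)).
  - by rewrite ger0_norm ?invr_ge0//; lra.
  - move=> n; rewrite /t doubleS 2!big_ord_recr/= !natrM !natrX [in RHS]/=.
    rewrite exprS -!mulrA.
    have -> : 3 ^+ n.*2.+1 = 3 * 9 ^+ n :> R.
      by rewrite exprS -mul2n exprM -natrX.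
    have -> : 3 ^+ n.*2 = 9 ^+ n :> R by rewrite -mul2n exprM -natrX.
    by rewrite exprVn; field; rewrite expf_neq0.
  rewrite (_ : (1 - 9^-1) * _ = 4 / 3 * l + 4 / 9 * l'); last by field.
  apply: cvgD; apply: cvgMr => //.
  by rewrite (cvg_shiftS (fun n => x n.*2)).
have ul : (fun N => (2 - 9^-1 ^+ N)^-1) @ \oo --> (2^-1 : R).
  apply: cvgV; first by [].
  rewrite -[X in _ --> X]subr0; apply: cvgB; first exact: cvg_cst.
  by apply: cvg_expr; rewrite ger0_norm ?invr_ge0//; lra.
have -> : 3 / 4 * l + 1 / 4 * l' = 2^-1 * (3 / 2 * l + 1 / 2 * l') by field.
apply: cvg_trans (cvgM ul tl); apply: near_eq_cvg; apply: nearW => N /=.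
rewrite /t mulrA; congr (_ * _).
have /(congr1 (fun k => k%:R : R)) := sum_sphere_size N.*2.
rewrite -natr1 natrM natrX -mul2n exprM -natrX => h.
have -> : (\sum_(n < (2 * N).+1) sphere_size n)%:R = 2 * 9 ^+ N - 1 :> R.
  by rewrite -[LHS](addrK 1) h.
rewrite exprVn.
have k1 : 1 <= 9 ^+ N :> R by rewrite exprn_ege1//; lra.
field; rewrite !gt_eqF//; lra.
Qed.

(** * Spheres and balls of the free group *)

Section FreeGroupSpheres.
Local Open Scope group_scope.

Definition gen (l : letter) : F2 := @MkF2 [:: l] isT.

Lemma word_gen_mul l (g : F2) : word (gen l * g) = cons_reduce l (word g).
Proof. by rewrite /= reduce_id// word_reduced. Qed.

Definition extends (l : letter) (g : F2) : bool := reduced (l :: word g).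

Lemma word_extend l g : extends l g -> word (gen l * g) = l :: word g.
Proof. by move=> ?; rewrite word_gen_mul cons_reduce_id. Qed.

Lemma gen_invK l g : gen (letter_inv l) * (gen l * g) = g.
Proof.
apply: (val_inj : injective word); rewrite !word_gen_mul -{2}(letter_invK l) cons_reduceK//.
exact: word_reduced.
Qed.

(** After prepending [l'], the only letter that cancels is the inverse of
    [l']. *)
Lemma extendsN_gen_mul l l' g : extends l' g ->
  ~~ extends l (gen l' * g) = (l == letter_inv l').
Proof.
move=> lg; rewrite {1}/extends word_extend//= -/(reduced _).
rewrite -[path _ _ _]/(reduced (l' :: word g)) (lg : reduced _) andbT negbK.
exact: letter_inv_sym.
Qed.

Fixpoint word_sphere (n : nat) : seq F2 :=
  if n is m.+1 then
    [seq gen l * g | g <- word_sphere m, l <- [seq l <- enum {: bool * bool} | extends l g]]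
  else [:: 1].

Lemma mem_sphere n g : (g \in word_sphere n) = (size (word g) == n).
Proof.
apply/idP/eqP.
  elim: n g => [|n IH] g /=; first by rewrite inE => /eqP ->.
  move=> /allpairsPdep[h [l [/IH hn]]].
  by rewrite mem_filter => /andP[lh _] ->; rewrite word_extend//= hn.
elim: n g => [|n IH] [[|l w] rw]//=.
move=> [wn]; apply/allpairsPdep.
have rw' : reduced w by exact: path_sorted rw.
exists (MkF2 rw'), l; split; first exact: IH.
  by rewrite mem_filter mem_enum andbT.
by apply: (val_inj : injective word); rewrite word_extend.
Qed.

Lemma sphere_uniq n : uniq (word_sphere n).
Proof.
elim: n => [//|n IH] /=; apply: allpairs_uniq_dep => //.
  by move=> g _; rewrite filter_uniq// enum_uniq.
move=> _ _ /allpairsPdep[g [l [_ + ->]]] /allpairsPdep[h [k [_ + ->]]] /=.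
rewrite !mem_filter => /andP[lg _] /andP[kh _] /(congr1 word).
by rewrite !word_extend// => -[-> gh]; congr existT; apply: val_inj.
Qed.

Lemma sphere_sumS (V : nmodType) n (F : F2 -> V) :
  (\sum_(g <- word_sphere n.+1) F g =
   \sum_(g <- word_sphere n) \sum_(l : bool * bool | extends l g) F (gen l * g)%g)%R.
Proof.
rewrite big_allpairs_dep/=; apply: eq_bigr => g _.
by rewrite big_filter big_enum_cond.
Qed.

(** Only the inverse of the first letter, if there is one, is excluded. *)
Lemma card_extends n g : g \in word_sphere n ->
  #|[pred l : bool * bool | extends l g]| = if n is 0 then 4 else 3.
Proof.
rewrite mem_sphere => /eqP <-; case: g => -[|k w] rw /=.
  rewrite (eq_card (_ : _ =i predT)); last by move=> ?; rewrite inE.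
  by rewrite card_prod card_bool.
apply/eqP; rewrite -(eqn_add2l 1).
rewrite -{1}(card1 (letter_inv k)) -[X in _ == X]/(2 * 2)%N -card_bool -card_prod.
rewrite -(cardC (pred1 (letter_inv k))); apply/eqP; congr (_ + _)%N.
apply: eq_card => l; rewrite !inE /extends /reduced/= -/(reduced _).
rewrite -[path _ _ _]/(reduced (k :: w)) rw andbT.
by rewrite letter_inv_sym.
Qed.

Lemma size_sphere n : size (word_sphere n) = sphere_size n.
Proof.
elim: n => // n IH; rewrite -sum1_size sphere_sumS.
under eq_big_seq => g gn do rewrite sum1_card (card_extends gn).
rewrite big_const_seq count_predT IH iter_addn_0.
by case: n {IH} => //= n; rewrite mulnCA expnS.
Qed.

(** Left multiplication by a letter either extends a word of length [n+1], and
    this reaches each word of length [n+2] once, or removes its first letter,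
    and this reaches a word of length [n] once for each of its extensions. *)
Lemma sphere_sum_gen (V : nmodType) n (F : F2 -> V) :
  (\sum_(g <- word_sphere n.+1) \sum_(l : bool * bool) F (gen l * g)%g =
   \sum_(g <- word_sphere n.+2) F g +
   (\sum_(g <- word_sphere n) F g) *+ (if n is 0 then 4 else 3))%R.
Proof.
rewrite (sphere_sumS n.+1).
under eq_bigr => g _ do rewrite (bigID (extends^~ g)) /=.
rewrite big_split; congr (_ + _)%R.
rewrite sphere_sumS -sumrMnl; apply: eq_big_seq => g gn.
rewrite -(card_extends gn) -sumr_const.
apply: eq_bigr => l lg.
rewrite (big_pred1 (letter_inv l)) ?gen_invK// => k.
exact: extendsN_gen_mul.
Qed.

(** The radius is [n.-1], to match sums over [i < n]. *)
Definition word_ball n : seq F2 := flatten [seq word_sphere i | i <- iota 0 n].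

Lemma mem_ball n g : (g \in word_ball n) = (size (word g) < n)%N.
Proof.
apply/flatten_mapP/idP => [[i]|gn].
  by rewrite mem_iota mem_sphere => /andP[_ iN] /eqP ->.
by exists (size (word g)); rewrite ?mem_iota ?mem_sphere.
Qed.

Lemma ball_uniq n : uniq (word_ball n).
Proof.
elim: n => // n IH; rewrite /word_ball -addn1 iotaD map_cat flatten_cat /= cats0.
rewrite cat_uniq IH sphere_uniq andbT add0n; apply/hasPn => g.
by rewrite mem_sphere mem_ball => /eqP ->; rewrite ltnn.
Qed.

Lemma ball_sum (V : nmodType) n (F : F2 -> V) :
  (\sum_(g <- word_ball n) F g = \sum_(i < n) \sum_(g <- word_sphere i) F g)%R.
Proof.
rewrite big_flatten big_map.
rewrite -(big_mkord xpredT (fun i => \sum_(g <- word_sphere i) F g)%R).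
by rewrite /index_iota subn0.
Qed.

End FreeGroupSpheres.

Lemma F2_ballE N : F2_ball N = [set` word_ball N.+1].
Proof. by apply/seteqP; split=> g; rewrite /F2_ball/= mem_ball. Qed.

Lemma card_F2_ball N :
  #|` fset_set (F2_ball N)|%fset = (\sum_(n < N.+1) sphere_size n)%N.
Proof.
rewrite F2_ballE.
have -> : [set` word_ball N.+1] = [set` [fset g in word_ball N.+1]%fset].
  by apply/seteqP; split=> g /=; rewrite in_fset.
rewrite set_fsetK card_fseq undup_id ?ball_uniq// -sum1_size ball_sum.
by apply: eq_bigr => i _; rewrite sum1_size size_sphere.
Qed.

(** * Moment functionals *)

Section MomentFunctional.
Variable R : comNzRingType.
Implicit Types (u : nat -> R) (P : {poly R}).

Definition moment u P : R := \sum_(i < size P) P`_i * u i.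

(** Any bound on the size may serve as range, which makes linearity visible. *)
Lemma momentE u P n : (size P <= n)%N -> moment u P = \sum_(i < n) P`_i * u i.
Proof.
move=> Pn; rewrite /moment (big_ord_widen _ (fun i => P`_i * u i) Pn) big_mkcond.
apply: eq_bigr => i _; case: ltnP => // iP.
by rewrite nth_default// mul0r.
Qed.

Lemma moment_linear u : scalar (moment u).
Proof.
move=> a P Q; pose n := maxn (size (a *: P + Q)) (maxn (size P) (size Q)).
rewrite !(@momentE _ _ n) ?leq_max ?leqnn ?orbT//.
rewrite mulr_sumr -big_split; apply: eq_bigr => i _ /=.
by rewrite coefD coefZ mulrDl mulrA.
Qed.

HB.instance Definition _ u :=
  GRing.isLinear.Build R {poly R} R *%R (moment u) (moment_linear u).

Lemma momentC u c : moment u c%:P = c * u 0.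
Proof. by rewrite (@momentE _ _ 1) ?size_polyC_leq1// big_ord1 coefC. Qed.

Lemma momentMX u P : moment u (P * 'X) = moment (fun i => u i.+1) P.
Proof.
rewrite (@momentE _ (P * 'X) (size P).+1).
  rewrite big_ord_recl coefMX/= mul0r add0r /moment.
  by apply: eq_bigr => i _; rewrite coefMX.
have [->|P0] := eqVneq P 0; first by rewrite mul0r size_poly0.
by rewrite size_mulX.
Qed.

End MomentFunctional.

(** * Expectation of bounded measurable functions *)

Section BoundedMeasurable.
Context d (X : measurableType d) (R : realType) (mu : probability X R).
Implicit Types F G : X -> R.

Definition bounded_measurable F :=
  measurable_fun setT F /\ exists M, forall x, `|F x| <= M.

Local Notation I F := (\int[mu]_x F x).

Lemma bounded_measurable_cst c : bounded_measurable (fun=> c).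
Proof. by split; [exact: measurable_cst|exists `|c|]. Qed.

Lemma bounded_measurableD F G : bounded_measurable F -> bounded_measurable G ->
  bounded_measurable (fun x => F x + G x).
Proof.
move=> [mF [M FM]] [mG [N GN]]; split; first exact: measurable_funD.
by exists (M + N) => x; rewrite (le_trans (ler_normD _ _))// lerD.
Qed.

Lemma bounded_measurableM F G : bounded_measurable F -> bounded_measurable G ->
  bounded_measurable (fun x => F x * G x).
Proof.
move=> [mF [M FM]] [mG [N GN]]; split; first exact: measurable_funM.
by exists (M * N) => x; rewrite normrM ler_pM.
Qed.

Lemma bounded_measurable_sum (J : Type) (r : seq J) (F : J -> X -> R) :
  (forall j, bounded_measurable (F j)) ->
  bounded_measurable (fun x => \sum_(j <- r) F j x).
Proof.
move=> bF; elim: r => [|j r IH].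
  under eq_fun => x do rewrite big_nil.
  exact: bounded_measurable_cst.
under eq_fun => x do rewrite big_cons.
exact: bounded_measurableD.
Qed.

Lemma bounded_measurable_comp F (S : X -> X) : measurable_fun setT S ->
  bounded_measurable F -> bounded_measurable (F \o S).
Proof.
move=> mS [mF [M FM]]; split; first exact: measurableT_comp.
by exists M => x /=.
Qed.

Lemma bounded_measurable_indic A : measurable A -> bounded_measurable (\1_A : X -> R).
Proof.
move=> mA; split; first exact: measurable_indic.
by exists 1 => x; rewrite indicE; case: (_ \in _); rewrite ?normr1// normr0.
Qed.

Lemma bounded_measurable_integrable F : bounded_measurable F ->
  mu.-integrable setT (EFin \o F).
Proof.
move=> [mF [M FM]]; apply: measurable_bounded_integrable => //.
  exact: le_lt_trans (probability_le1 mu measurableT) (ltry 1).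
exists M; split; first exact: num_real.
by move=> y My x _ /=; apply: le_trans (FM x) (ltW My).
Qed.

Lemma expectD F G : bounded_measurable F -> bounded_measurable G ->
  I (fun x => F x + G x) = I F + I G.
Proof.
by move=> bF bG; rewrite RintegralD//; exact: bounded_measurable_integrable.
Qed.

Lemma expectZ c F : bounded_measurable F -> I (fun x => c * F x) = c * I F.
Proof. by move=> bF; rewrite RintegralZl//; exact: bounded_measurable_integrable. Qed.

Lemma expect_sum (J : Type) (r : seq J) (F : J -> X -> R) :
  (forall j, bounded_measurable (F j)) ->
  I (fun x => \sum_(j <- r) F j x) = \sum_(j <- r) I (F j).
Proof.
move=> bF; elim: r => [|j r IH].
  under eq_Rintegral => x _ do rewrite big_nil.
  by rewrite big_nil Rintegral_cst// mul0r.
under eq_Rintegral => x _ do rewrite big_cons.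
by rewrite big_cons expectD ?IH//; exact: bounded_measurable_sum.
Qed.

Lemma expect_le F G : bounded_measurable F -> bounded_measurable G ->
  (forall x, F x <= G x) -> I F <= I G.
Proof.
by move=> bF bG FG; apply: le_Rintegral => //; exact: bounded_measurable_integrable.
Qed.

Lemma expect_cst c : I (fun=> c) = c.
Proof. by rewrite Rintegral_cst// [X in fine X](probability_setT mu) mulr1. Qed.

Lemma expect_indic A : measurable A -> I (\1_A : X -> R) = fine (mu A).
Proof. by move=> mA; rewrite /Rintegral integral_indic// setIT. Qed.

Lemma expect_comp F (S : X -> X) : measurable_fun setT S ->
  (forall A, measurable A -> mu (S @^-1` A) = mu A) ->
  bounded_measurable F -> I (F \o S) = I F.
Proof.
move=> mS muS bF; have [mF _] := bF.
rewrite /Rintegral; congr fine.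
have := @integral_pushforward _ _ _ _ _ S mS mu setT (EFin \o F).
rewrite preimage_setT => <- //.
- by apply: eq_measure_integral => A mA _; rewrite /= /pushforward muS.
- exact/measurable_EFinP.
- apply: bounded_measurable_integrable; exact: bounded_measurable_comp.
Qed.

End BoundedMeasurable.

(** * The Markov operator of a measure-preserving action *)

Lemma gen_inv l : (gen l)^-1%g = gen (letter_inv l).
Proof. by apply: val_inj; rewrite /= /inv_word. Qed.

Section Dynamics.
Context (R : realType) d (X : measurableType d) (mu : probability X R).
Variables (T : F2 -> X -> X) (hT : measure_preserving_action mu T).
Local Notation I F := (\int[mu]_x F x).
Local Notation bm := (@bounded_measurable d X R).
Implicit Types F G : X -> R.

(** The inverses turn left multiplication of words into composition:
    [markov] sends [f \o T g^-1] to the average of the functions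
    [f \o T (l g)^-1]. *)
Definition markov F x : R := 4^-1 * \sum_(l : bool * bool) F (T (gen l)^-1%g x).

Lemma bounded_measurable_act g F : bm F -> bm (fun x => F (T g x)).
Proof. by move=> bF; apply: bounded_measurable_comp => //; exact: mp_measurable hT g. Qed.

Lemma expect_act g F : bm F -> I (fun x => F (T g x)) = I F.
Proof.
move=> bF; apply: expect_comp bF; first exact: mp_measurable hT g.
exact: mp_preserving hT g.
Qed.

Lemma act_invK g x : T g^-1%g (T g x) = x.
Proof. by rewrite -[LHS]/((T g^-1%g \o T g) x) -(mp_actM hT) mulVg (mp_act1 hT). Qed.

Lemma act_Kinv g x : T g (T g^-1%g x) = x.
Proof. by rewrite -[LHS]/((T g \o T g^-1%g) x) -(mp_actM hT) mulgV (mp_act1 hT). Qed.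

Lemma bounded_measurable_markov F : bm F -> bm (markov F).
Proof.
move=> bF; apply: bounded_measurableM; first exact: bounded_measurable_cst.
by apply: bounded_measurable_sum => l; exact: bounded_measurable_act.
Qed.

Lemma expect_markovM F G : bm F -> bm G ->
  I (fun x => markov F x * G x) =
  4^-1 * \sum_(l : bool * bool) I (fun x => F (T (gen l)^-1%g x) * G x).
Proof.
move=> bF bG; rewrite -expect_sum => [|l]; last first.
  by apply: bounded_measurableM => //; exact: bounded_measurable_act.
rewrite -expectZ; last first.
  apply: bounded_measurable_sum => l.
  by apply: bounded_measurableM => //; exact: bounded_measurable_act.
by apply: eq_Rintegral => x _; rewrite /markov -mulrA mulr_suml.
Qed.

(** Invariance of the measure moves [T l^-1] on [F] to [T l] on [G], and the set
    of letters is closed under inversion. *)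
Lemma markov_selfadjoint F G : bm F -> bm G ->
  I (fun x => markov F x * G x) = I (fun x => F x * markov G x).
Proof.
move=> bF bG.
under [RHS]eq_Rintegral => x _ do rewrite mulrC.
rewrite !expect_markovM//; congr (_ * _).
have inv_bij : bijective letter_inv by exists letter_inv; exact: letter_invK.
rewrite (reindex letter_inv)/=; last exact: onW_bij.
apply: eq_bigr => l _.
rewrite -(expect_act (gen l)^-1%g); last first.
  by apply: bounded_measurableM => //; exact: bounded_measurable_act.
by apply: eq_Rintegral => x _; rewrite -(gen_inv l) act_invK mulrC.
Qed.

Lemma sqr_markov_le F x : markov F x ^+ 2 <= markov (fun y => F y ^+ 2) x.
Proof.
have sumE (h : bool * bool -> R) : \sum_l h l =
    h (true, true) + h (true, false) + (h (false, true) + h (false, false)).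
  rewrite (eq_bigr (fun p => h (p.1, p.2))); last by case.
  by rewrite -(pair_bigA _ (fun a b => h (a, b))) big_bool !big_bool.
rewrite /markov !sumE.
move: (F _) (F _) (F _) (F _) => a b c e.
rewrite -subr_ge0.
have -> : 4^-1 * (e ^+ 2 + c ^+ 2 + (b ^+ 2 + a ^+ 2)) -
    (4^-1 * (e + c + (b + a))) ^+ 2 = 16^-1 * ((a - b) ^+ 2 + (a - c) ^+ 2 +
    (a - e) ^+ 2 + (b - c) ^+ 2 + (b - e) ^+ 2 + (c - e) ^+ 2) by field.
by rewrite mulr_ge0 ?invr_ge0// !addr_ge0 ?sqr_ge0.
Qed.

Lemma bounded_measurable_sqr F : bm F -> bm (fun x => F x ^+ 2).
Proof. by move=> bF; under eq_fun => x do rewrite expr2; exact: bounded_measurableM. Qed.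

(** Pointwise, the square of an average is at most the average of the squares,
    and averaging preserves the integral. *)
Lemma markov_contract F : bm F ->
  I (fun x => markov F x ^+ 2) <= I (fun x => F x ^+ 2).
Proof.
move=> bF; have bF2 := bounded_measurable_sqr bF.
have /le_trans : I (fun x => markov F x ^+ 2) <= I (markov (fun y => F y ^+ 2)).
  apply: expect_le; last exact: sqr_markov_le.
    exact/bounded_measurable_sqr/bounded_measurable_markov.
  exact: bounded_measurable_markov.
apply.
have := expect_markovM bF2 (bounded_measurable_cst X 1).
under eq_Rintegral => x _ do rewrite mulr1.
move=> ->.
under eq_bigr => l _.
  under eq_Rintegral => x _ do rewrite mulr1.
  rewrite (expect_act (gen l)^-1%g bF2).
over.
rewrite sumr_const card_prod card_bool.
by rewrite -[X in _ * X]mulr_natl mulrA mulVf ?mul1r.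
Qed.

Section Cyclic.
Variables (f : X -> R) (bf : bm f).

Definition markov_poly (P : {poly R}) x : R :=
  moment (fun i => iter i markov f x) P.

(** [<P(A) f, f>], the integral of [P] against the spectral measure of [f]. *)
Definition spectral (P : {poly R}) : R :=
  moment (fun i => I (fun x => iter i markov f x * f x)) P.

HB.instance Definition _ := GRing.Linear.copy spectral
  (moment (fun i => I (fun x => iter i markov f x * f x))).

Lemma bounded_measurable_iter i : bm (iter i markov f).
Proof. by elim: i => //= i IH; exact: bounded_measurable_markov. Qed.

Lemma bounded_measurable_markov_poly P : bm (markov_poly P).
Proof.
apply: bounded_measurable_sum => i.
apply: bounded_measurableM; first exact: bounded_measurable_cst.
exact: bounded_measurable_iter.
Qed.

Lemma markov_markov_poly P : markov (markov_poly P) = markov_poly (P * 'X).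
Proof.
apply: funext => x; rewrite /markov_poly momentMX /markov /moment mulr_sumr.
under eq_bigr => l _ do rewrite mulr_sumr.
rewrite exchange_big/=; apply: eq_bigr => i _.
by rewrite !mulr_sumr; apply: eq_bigr => l _; rewrite mulrCA.
Qed.

Lemma expect_markov_poly P : I (fun x => markov_poly P x * f x) = spectral P.
Proof.
have bi i : bm (fun x => iter i markov f x * f x).
  by apply: bounded_measurableM => //; exact: bounded_measurable_iter.
rewrite /spectral /moment.
under eq_Rintegral => x _ do rewrite mulr_suml.
rewrite expect_sum => [|i]; last first.
  apply: bounded_measurableM => //; apply: bounded_measurableM.
    exact: bounded_measurable_cst.
  exact: bounded_measurable_iter.
apply: eq_bigr => i _.
by under eq_Rintegral => x _ do rewrite -mulrA; rewrite expectZ.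
Qed.

(** Self-adjointness moves the factors ['X] of [Q] one by one onto [P]. *)
Lemma expect_markov_polyM P Q :
  I (fun x => markov_poly P x * markov_poly Q x) = spectral (P * Q).
Proof.
have bp := bounded_measurable_markov_poly.
elim/poly_ind: Q P => [|Q c IH] P.
  under eq_Rintegral => x _ do rewrite /markov_poly linear0 mulr0.
  by rewrite expect_cst mulr0 linear0.
have -> : P * (Q * 'X + c%:P) = P * 'X * Q + c *: P by rewrite -mul_polyC; ring.
rewrite linearD linearZ/= -IH -expect_markov_poly -markov_markov_poly.
rewrite markov_selfadjoint// markov_markov_poly -expectZ; last exact: bounded_measurableM.
rewrite -expectD; last 2 first.
- exact: bounded_measurableM.
- apply: bounded_measurableM; first exact: bounded_measurable_cst.
  exact: bounded_measurableM.
apply: eq_Rintegral => x _.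
rewrite [X in _ * X](_ : _ = markov_poly (Q * 'X) x + c * f x); first by ring.
by rewrite /markov_poly linearD/= momentC.
Qed.

(** [L (Q^2)] is the squared norm of [Q(A) f], and [L ((1 - 'X^2) Q^2)] is what
    that squared norm loses when [A] is applied. *)
Lemma spectral_positive : positive_on_itv spectral.
Proof.
have bp := bounded_measurable_markov_poly.
have spE P : spectral (P ^+ 2) = I (fun x => markov_poly P x ^+ 2).
  rewrite expr2 -expect_markov_polyM.
  by apply: eq_Rintegral => x _; rewrite expr2.
move=> Q; split.
  by rewrite spE; apply: Rintegral_ge0 => x _; exact: sqr_ge0.
rewrite (_ : _ * _ = Q ^+ 2 - (Q * 'X) ^+ 2); last by ring.
rewrite linearB/= subr_ge0 !spE -markov_markov_poly; exact: markov_contract.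
Qed.

Lemma markov_sphere n x :
  4 * markov (fun y => \sum_(g <- word_sphere n) f (T g^-1%g y)) x =
  \sum_(g <- word_sphere n) \sum_(l : bool * bool) f (T (gen l * g)^-1%g x).
Proof.
rewrite /markov mulrA mulfV// mul1r exchange_big/=; apply: eq_bigr => g _.
by apply: eq_bigr => l _; rewrite invgM (mp_actM hT).
Qed.

Lemma markovZ c F x : markov (fun z => c * F z) x = c * markov F x.
Proof. by rewrite /markov -mulr_sumr mulrCA. Qed.

(** Both sides satisfy the recurrence of [sphere_poly]: for the right-hand side
    this is [sphere_sum_gen], the number of extensions of a word of length [n]
    being the ratio of the sizes of the spheres of radii [n+1] and [n]. *)
Lemma sphere_sum_markov n x : (sphere_size n)%:R * markov_poly (sphere_poly R n) x =
  \sum_(g <- word_sphere n) f (T g^-1%g x).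
Proof.
(* The recurrence has two steps, so the induction carries two consecutive radii. *)
suff: (forall y, (sphere_size n)%:R * markov_poly (sphere_poly R n) y =
         \sum_(g <- word_sphere n) f (T g^-1%g y)) /\
      (forall y, (sphere_size n.+1)%:R * markov_poly (sphere_poly R n.+1) y =
         \sum_(g <- word_sphere n.+1) f (T g^-1%g y)) by case=> + _; apply.
elim: n {x} => [|n [IH0 IH1]]; last first.
  split => // x.
  have : 4 * markov (fun y => \sum_(g <- word_sphere n.+1) f (T g^-1%g y)) x =
      4 * ((sphere_size n.+1)%:R * markov_poly (sphere_poly R n.+1 * 'X) x).
    rewrite -markov_markov_poly -(markovZ (sphere_size _)%:R).
    congr (_ * _); apply: (congr1 (fun F => markov F x)).
    by apply: funext => y; rewrite IH1.
  rewrite markov_sphere (sphere_sum_gen n (fun g => f (T g^-1%g x))) -IH0.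
  move=> /esym/eqP; rewrite -subr_eq => /eqP <-.
  have : 3 * markov_poly (sphere_poly R n.+2) x =
      4 * markov_poly (sphere_poly R n.+1 * 'X) x - markov_poly (sphere_poly R n) x.
    rewrite /markov_poly -!functional_natM sphere_polySS linearB/=.
    by rewrite -mulrA ['X * _]mulrC.
  move: (markov_poly (sphere_poly R n.+2) x) (markov_poly (_ * 'X) x)
    (markov_poly (sphere_poly R n) x) => a b c abc.
  have -> : (sphere_size n.+2)%:R * a = (sphere_size n.+1)%:R * (3 * a).
    by rewrite mulrA -natrM /= expnSr mulnA.
  rewrite abc mulrBr mulrCA; congr (_ - _).
  rewrite -mulrnAl -mulrnA; congr (_%:R * _).
  by case: n {IH0 IH1 abc} => [|n] //=; rewrite expnSr mulnA.
have p0 x : markov_poly (sphere_poly R 0) x = f x.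
  by rewrite /markov_poly sphere_poly0 -[1]/(1%:P) momentC mul1r.
have s0 x : \sum_(g <- word_sphere 0) f (T g^-1%g x) = f x.
  by rewrite big_seq1 invg1 (mp_act1 hT).
split=> x; first by rewrite mul1r p0 s0.
have -> : sphere_poly R 1 = sphere_poly R 0 * 'X by rewrite sphere_poly0 mul1r.
rewrite -markov_markov_poly (_ : markov_poly _ = fun y => \sum_(g <- word_sphere 0) f (T g^-1%g y)).
  rewrite -[(sphere_size 1)%:R]/4 markov_sphere sphere_sumS.
  by apply: eq_big_seq => g; rewrite mem_seq1 => /eqP ->.
by apply: funext => y; rewrite p0 s0.
Qed.

Lemma spectral_sphere n :
  \sum_(g <- word_sphere n) I (fun x => f (T g^-1%g x) * f x) =
  (sphere_size n)%:R * spectral (sphere_poly R n).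
Proof.
have bfg (g : F2) : bm (fun x => f (T g^-1%g x) * f x).
  by apply: bounded_measurableM => //; exact: bounded_measurable_act.
rewrite -expect_sum// -expect_markov_poly -expectZ; last first.
  by apply: bounded_measurableM => //; exact: bounded_measurable_markov_poly.
by apply: eq_Rintegral => x _; rewrite mulrA sphere_sum_markov mulr_suml.
Qed.

End Cyclic.

(** Centering [1_Y] subtracts [mu(Y)^2] from each correlation: this turns the
    lower bound of the theorem into nonnegativity. *)
Lemma correlation_centered (Y : set X) (g : F2) : measurable Y ->
  I (fun x => (\1_Y (T g^-1%g x) - fine (mu Y)) * (\1_Y x - fine (mu Y))) =
  fine (mu (Y `&` T g @` Y)) - fine (mu Y) ^+ 2.
Proof.
move=> mY; set m := fine (mu Y).
have bY := @bounded_measurable_indic _ X R _ mY.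
have bgY := bounded_measurable_act g^-1%g bY.
have bc := @bounded_measurable_cst _ X R.
have gYE : T g @` Y = T g^-1%g @^-1` Y.
  apply/seteqP; split=> [_ [x Yx <-]|x Yx]; first by rewrite /preimage/= act_invK.
  by exists (T g^-1%g x) => //; rewrite act_Kinv.
have mgY : measurable (T g @` Y).
  by rewrite gYE -[X in measurable X]setTI; exact: mp_measurable hT _ measurableT _ mY.
have mYg : measurable (Y `&` T g @` Y) by exact: measurableI.
transitivity (I (fun x => \1_(Y `&` T g @` Y) x +
    (- m * \1_Y x + (- m * \1_Y (T g^-1%g x) + m ^+ 2)))).
  apply: eq_Rintegral => x _.
  have -> : \1_(Y `&` T g @` Y) x = \1_Y x * \1_Y (T g^-1%g x) :> R.
    by rewrite indicI/= gYE !indicE.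
  ring.
rewrite expectD; [|exact: bounded_measurable_indic|]; last first.
  by do ![apply: bounded_measurableD|apply: bounded_measurableM].
rewrite expectD; [|exact: bounded_measurableM|]; last first.
  by do ![apply: bounded_measurableD|apply: bounded_measurableM].
rewrite expectD//; last exact: bounded_measurableM.
rewrite !expectZ// expect_cst (expect_act g^-1%g bY) !expect_indic// -/m; ring.
Qed.

End Dynamics.

(** * Convergence of the correlation averages *)

Theorem theorem1p9 (R : realType) (d : measure_display) (X : measurableType d)
    (mu : probability X R) (T : F2 -> X -> X)
    (hT : measure_preserving_action mu T) (Y : set X) (hY : measurable Y) :
  let avg : nat -> R := fun N =>
    (#|` fset_set (F2_ball (2 * N))|%fset%:R)^-1 *
      \sum_(g \in F2_ball (2 * N)) fine (mu (Y `&` T g @` Y)) in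
  cvg (avg @ \oo) /\ fine (mu Y) ^+ 2 <= lim (avg @ \oo).
Proof.
move=> avg; set m := fine (mu Y).
pose f x : R := \1_Y x - m.
have bf : bounded_measurable f.
  apply: bounded_measurableD; first exact: bounded_measurable_indic.
  exact: bounded_measurable_cst.
pose L := spectral mu T f.
have Lpos : positive_on_itv L := spectral_positive hT bf.
have [l l0 pl] := sphere_poly_even_cvg Lpos.
have [l' l'0 pl'] := sphere_poly_odd_cvg Lpos pl.
have avgE : avg = fun N => (\sum_(n < N.*2.+1) sphere_size n)%:R^-1 *
    \sum_(n < N.*2.+1) (sphere_size n)%:R * L (sphere_poly R n) + m ^+ 2.
  apply: funext => N; rewrite /avg card_F2_ball F2_ballE -fsbig_seq ?ball_uniq//.
  rewrite ball_sum mul2n.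
  set k := (\sum_(n < _) sphere_size n)%N.
  have k0 : k%:R != 0 :> R.
    by rewrite pnatr_eq0 /k big_ord_recl -lt0n addn_gt0.
  have -> : m ^+ 2 = k%:R^-1 * \sum_(n < N.*2.+1) (sphere_size n)%:R * m ^+ 2.
    by rewrite -mulr_suml -natr_sum mulrA mulVf// mul1r.
  rewrite -mulrDr -big_split; congr (_ * _); apply: eq_bigr => n _ /=.
  rewrite -(spectral_sphere hT bf) -size_sphere -sum1_size natr_sum mulr_suml.
  rewrite -big_split; apply: eq_bigr => g _ /=.
  by rewrite (correlation_centered hT) // mul1r subrK.
have avg_cvg : avg @ \oo --> 3 / 4 * l + 1 / 4 * l' + m ^+ 2.
  rewrite avgE; apply: cvgD; last exact: cvg_cst.
  exact: (@ball_average_cvg _ (fun n => L (sphere_poly R n))).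
split; first by apply/cvg_ex; exists (3 / 4 * l + 1 / 4 * l' + m ^+ 2).
rewrite (cvg_lim _ avg_cvg)// lerDr; lra.
Qed.
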